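(* Let $\mathcal{A}$ be a finite algebra. (1) If $\mathcal{B}$ is a subalgebra of $\mathcal{A}$, then $\mathsf{QCSP}^{\exists}(\mathcal{B})$ uniformly reduces to $\mathsf{QCSP}^{\exists}(\mathcal{A})$. (2) If $\mathcal{B}$ is a homomorphic image of $\mathcal{A}$, then $\mathsf{QCSP}^{\exists}(\mathcal{B})$ uniformly reduces to $\mathsf{QCSP}^{\exists}(\mathcal{A})$.
   Context: For a set $F$ of finitary operations on a finite nonempty set $D$, $\mathsf{Inv}(F)$ is the set of all finitary relations $R\subseteq D^m$ such that every $\mu\in F$ (of arity $k$) applied coordinatewise to any $k$ tuples of $R$ yields a tuple of $R$. For an algebra $\mathcal{A}$ with universe $D$ and set of operations $F$, $\mathsf{QCSP}^{\exists}(\mathcal{A})$ denotes $\mathsf{QCSP}^{\exists}(\mathsf{Inv}(F))$. A quantified formula is $\exists X_1\forall Y_1\exists X_2\forall Y_2\cdots\exists X_t\,\mathcal{C}$ with pairwise disjoint variable blocks, all nonempty except possibly $X_1$. An extended constraint over $D$ is $(y_1=d_1)\wedge\cdots\wedge(y_m=d_m)\Rightarrow R(x_1,\dots,x_k)$ with $m\ge0$, $y_i$ universally quantified variables, $x_i$ existentially quantified variables, $d_i\in D$, $R\subseteq D^k$; it is true iff $R(x_1,\dots,x_k)$ holds or some $y_i\ne d_i$. $\mathsf{QCSP}^{\exists}(\Gamma)$ is the problem of deciding truth of quantified formulas whose $\mathcal{C}$ is a conjunction of extended constraints with relations from $\Gamma$. A uniform reduction is a polynomial-time many-one reduction that does not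 increase the number of nonempty quantifier blocks. *)

(* Defs.v *)
From Stdlib Require List.
From mathcomp Require Import all_boot.

Set Implicit Arguments.
Unset Strict Implicit.
Unset Printing Implicit Defensive.

(** * Relations, invariance, algebras *)

Record relation (D : finType) := Relation {
  rel_arity : nat;
  rel_set :> {set rel_arity.-tuple D}
}.

Definition language (D : finType) := relation D -> Prop.

Definition operations (D : finType) := forall k : nat, (k.-tuple D -> D) -> Prop.

Definition coordinatewise (D : finType) (k m : nat) (mu : k.-tuple D -> D)
    (ts : k.-tuple (m.-tuple D)) : m.-tuple D :=
  [tuple mu [tuple tnth (tnth ts j) i | j < k] | i < m].

Definition Inv (D : finType) (F : operations D) : language D := fun R =>
  forall (k : nat) (mu : k.-tuple D -> D), F k mu ->
  forall ts : k.-tuple ((rel_arity R).-tuple D),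
    (forall j : 'I_k, tnth ts j \in rel_set R) ->
    coordinatewise mu ts \in rel_set R.

Record signature := Signature { symbol : Type; arity : symbol -> nat }.

Record algebra (s : signature) := Algebra {
  universe :> finType;
  universe_nonempty : 0 < #|universe|;
  op : forall f : symbol s, (arity f).-tuple universe -> universe
}.

Inductive basic_op (s : signature) (A : algebra s) : operations A :=
  BasicOp (f : symbol s) : basic_op (op (a := A) (f := f)).

Record subuniverse (s : signature) (A : algebra s) := Subuniverse {
  carrier :> {set A};
  carrier_nonempty : 0 < #|carrier|;
  carrier_closed : forall (f : symbol s) (t : (arity f).-tuple A),
    {subset t <= carrier} -> op t \in carrier
}.

Section Subalgebra.
Variables (s : signature) (A : algebra s) (S : subuniverse A).

Definition sub_universe : finType := {x : A | x \in carrier S}.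

Lemma sub_nonempty : 0 < #|sub_universe|.
Proof. by rewrite card_sig carrier_nonempty. Qed.

Lemma sub_closed (f : symbol s) (t : (arity f).-tuple sub_universe) :
  op (map_tuple val t) \in carrier S.
Proof. by apply: carrier_closed => _ /mapP[x _ ->]; exact: valP. Qed.

Definition subalgebra : algebra s :=
  @Algebra s sub_universe sub_nonempty
    (fun f t => exist _ (op (map_tuple val t)) (sub_closed t)).
End Subalgebra.

Definition homomorphism (s : signature) (A B : algebra s) (h : A -> B) : Prop :=
  forall (f : symbol s) (t : (arity f).-tuple A), h (op t) = op (map_tuple h t).

Definition homomorphic_image (s : signature) (A B : algebra s) : Prop :=
  exists h : A -> B, homomorphism h /\ forall b : B, exists a : A, h a = b.

(** * Quantified formulas with extended constraints *)

(* Variable names are binary words. *)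
Definition var := bitseq.

(* [(y_1 = d_1) /\ ... /\ (y_m = d_m) => R(x_1, ..., x_k)]: the pairs
   [(y_i, d_i)] form [premises], and [(x_1, ..., x_k)] is [scope]. *)
Record ext_constraint (D : finType) := ExtConstraint {
  premises : seq (var * D);
  constraint_rel : relation D;
  scope : (rel_arity constraint_rel).-tuple var
}.

(* [exists X_1 forall Y_1 exists X_2 ... forall Y_(t-1) exists X_t, C]:
   [first_block] is [X_1], and [later_blocks] lists the pairs
   [(Y_i, X_(i+1))] for [1 <= i < t]. *)
Record formula (D : finType) := Formula {
  first_block : seq var;
  later_blocks : seq (seq var * seq var);
  constraints : seq (ext_constraint D)
}.

Section Formulas.
Variable D : finType.
Implicit Types (c : ext_constraint D) (phi : formula D) (a b : var -> D).

Definition blocks phi : seq (seq var) :=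
  first_block phi :: flatten [seq [:: p.1; p.2] | p <- later_blocks phi].

Definition universal_vars phi : seq var := flatten (unzip1 (later_blocks phi)).

Definition existential_vars phi : seq var :=
  first_block phi ++ flatten (unzip2 (later_blocks phi)).

Definition well_formed phi : bool :=
  [&& uniq (flatten (blocks phi)),
      all (fun X => X != [::]) (behead (blocks phi)) &
      all (fun c => all (fun p => p.1 \in universal_vars phi) (premises c) &&
                    all (fun x => x \in existential_vars phi) (scope c))
          (constraints phi)].

Definition nonempty_blocks phi : nat := count (fun X => X != [::]) (blocks phi).

Definition satisfies a c : bool :=
  all (fun p => a p.1 == p.2) (premises c) ==>
  (map_tuple a (scope c) \in rel_set (constraint_rel c)).

Definition override (X : seq var) b a : var -> D :=
  fun v => if v \in X then b v else a v.

Fixpoint eval (qs : seq (seq var * seq var)) (cs : seq (ext_constraint D)) a : Prop :=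
  if qs is (Y, X) :: qs' then
    forall b, exists b', eval qs' cs (override X b' (override Y b a))
  else all (satisfies a) cs.

(* The outermost assignment chooses the values of [X_1]; its values on the
   other variables of a well-formed formula are overridden before use. *)
Definition truth phi : Prop :=
  exists a, eval (later_blocks phi) (constraints phi) a.

End Formulas.

(** * The problems QCSP^exists *)

Record quantified_problem := QuantifiedProblem {
  domain : finType;
  is_instance : formula domain -> Prop;
  is_yes : formula domain -> Prop
}.

Definition QCSPE_lang (D : finType) (Gamma : language D) : quantified_problem :=
  QuantifiedProblem
    (fun phi => well_formed phi /\
       forall c, List.In c (constraints phi) -> Gamma (constraint_rel c))
    (@truth D).

Definition QCSPE (s : signature) (A : algebra s) : quantified_problem :=
  QCSPE_lang (Inv (@basic_op s A)).

(** * Encoding of instances as binary words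

    Every code is self-delimiting.  A relation is given by its truth table: the
    characteristic bits of all [k]-tuples over [D], in lexicographic order; [k]
    is known from the preceding scope.  An element of [D] is given by its rank
    in unary, which has bounded length since [D] is fixed. *)

Definition code_seq (T : Type) (code : T -> bitseq) (xs : seq T) : bitseq :=
  flatten [seq true :: code x | x <- xs] ++ [:: false].

Definition code_var (v : var) : bitseq := code_seq (fun b => [:: b]) v.

Section Encoding.
Variable D : finType.

Definition code_elt (d : D) : bitseq := rcons (nseq (enum_rank d) true) false.

(* [enum {: k.-tuple D}] would not do: its order is sealed in the library. *)
Fixpoint lex_tuples (k : nat) : seq (k.-tuple D) :=
  match k return seq (k.-tuple D) with
  | 0 => [:: [tuple]]
  | k'.+1 => [seq cons_tuple x t | x <- enum D, t <- lex_tuples k']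
  end.

Definition code_rel (R : relation D) : bitseq :=
  [seq t \in rel_set R | t <- lex_tuples (rel_arity R)].

Definition code_constraint (c : ext_constraint D) : bitseq :=
  code_seq (fun p => code_var p.1 ++ code_elt p.2) (premises c) ++
  code_seq code_var (scope c) ++ code_rel (constraint_rel c).

Definition code_formula (phi : formula D) : bitseq :=
  code_seq code_var (first_block phi) ++
  code_seq (fun p => code_seq code_var p.1 ++ code_seq code_var p.2)
    (later_blocks phi) ++
  code_seq code_constraint (constraints phi).

End Encoding.

(** * Multitape Turing machines and polynomial time *)

(* [None] is the blank, [Some (inl b)] an input/output bit, and
   [Some (inr w)] an auxiliary symbol. *)
Definition cell (W : finType) : finType := option (bool + W).

Inductive move := MoveLeft | Stay | MoveRight.

(* [tm_step q syms = None] means that the machine halts. *)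
Record turing_machine := TuringMachine {
  tm_tapes : nat;
  tm_aux : finType;
  tm_state : finType;
  tm_start : tm_state;
  tm_step : tm_state -> {ffun 'I_tm_tapes.+1 -> cell tm_aux} ->
            option (tm_state * {ffun 'I_tm_tapes.+1 -> cell tm_aux}
                             * ('I_tm_tapes.+1 -> move))
}.

(* [tape_left] is listed from the head outwards; all cells beyond the two lists
   are blank. *)
Record tape (W : finType) := Tape {
  tape_left : seq (cell W);
  tape_head : cell W;
  tape_right : seq (cell W)
}.

Definition write_move (W : finType) (x : cell W) (m : move) (t : tape W) : tape W :=
  let: Tape l _ r := t in
  match m with
  | MoveLeft => Tape (behead l) (head None l) (x :: r)
  | Stay => Tape l x r
  | MoveRight => Tape (x :: l) (head None r) (behead r)
  end.

Section Run.
Variable M : turing_machine.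

Definition config := (tm_state M * ('I_(tm_tapes M).+1 -> tape (tm_aux M)))%type.

Definition next_config (c : config) : option config :=
  if tm_step c.1 [ffun i => tape_head (c.2 i)] is Some (q, x, m)
  then Some (q, fun i => write_move (x i) (m i) (c.2 i))
  else None.

(* The halting configuration reached from [c] if at most [n] steps are needed. *)
Fixpoint run (n : nat) (c : config) : option config :=
  if next_config c is Some c' then
    if n is n'.+1 then run n' c' else None
  else Some c.

Definition input_tape (w : bitseq) : tape (tm_aux M) :=
  let cells : seq (cell (tm_aux M)) := [seq Some (inl b) | b <- w] in
  Tape [::] (head None cells) (behead cells).

Definition initial_config (w : bitseq) : config :=
  (tm_start M, fun i => if i == ord0 then input_tape w else Tape [::] None [::]).

Fixpoint leading_bits (s : seq (cell (tm_aux M))) : bitseq :=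
  if s is Some (inl b) :: s' then b :: leading_bits s' else [::].

(* The output is the word of bits that starts under the head of the last tape. *)
Definition output (c : config) : bitseq :=
  let t := c.2 ord_max in leading_bits (tape_head t :: tape_right t).

Definition computes_within (n : nat) (w v : bitseq) : Prop :=
  exists c : config, run n (initial_config w) = Some c /\ output c = v.

End Run.

(* Every polynomial is bounded by some [n |-> C * n ^ e + C]. *)
Definition polynomial_time (I J : Type) (P : I -> Prop)
    (codeI : I -> bitseq) (codeJ : J -> bitseq) (f : I -> J) : Prop :=
  exists (M : turing_machine) (C e : nat), forall x : I, P x ->
    computes_within M (C * size (codeI x) ^ e + C) (codeI x) (codeJ (f x)).

Definition uniformly_reduces (P Q : quantified_problem) : Prop :=
  exists f : formula (domain P) -> formula (domain Q),
    polynomial_time (@is_instance P) (@code_formula (domain P))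
      (@code_formula (domain Q)) f /\
    forall phi : formula (domain P), is_instance phi ->
      [/\ is_instance (f phi),
          is_yes phi <-> is_yes (f phi)
        & nonempty_blocks (f phi) <= nonempty_blocks phi].

(* Main.v *)
From Stdlib Require List.
Require Import Defs.
From mathcomp Require Import all_boot zify.

Set Implicit Arguments.
Unset Strict Implicit.
Unset Printing Implicit Defensive.

(** Fix [e : B -> A] and [p : A -> B] with [p \o e = id], and a predicate [P] on [A]
    that holds on the image of [e]: for a subalgebra, [e] is the inclusion, [P] the
    carrier and [p] any retraction; for a surjective homomorphism [p], [e] is a
    section and [P] is trivial.  The reduction keeps all variables and blocks, turns
    a premise [y = d] into [y = e d], and a relation [R] into the set of tuples
    that lie in [P] and are mapped into [R] by [p].  Universal values outside the image of
    [e] only deactivate constraints, and existential values outside [P] occur in no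
    active constraint, so winning strategies translate along [e] and [p].

    The substantial part of the computation is to turn the truth table of a [k]-ary
    relation over [B] into one over [A].  It takes [k] rounds; each round replaces the
    last coordinate of the table by a new first coordinate that ranges over [A].  If
    [#|B| >= 2] the new table is polynomially larger.  If [#|B| = 1] it need not be,
    and [R] is replaced by a nullary relation instead. *)

(** * Stack programs *)

Section StackPrograms.
Variable n : nat.

Inductive prog :=
  | Skip
  | Push of 'I_n.+1 & bool
  | Pop of 'I_n.+1
  | Seq of prog & prog
  | If of 'I_n.+1 & (option bool -> bool) & prog & prog
  | While of 'I_n.+1 & (option bool -> bool) & prog.

Implicit Types (p q : prog) (st : seq bitseq) (i j : 'I_n.+1) (b : option bool -> bool).

Definition top st i : option bool := ohead (nth [::] st i).

(* A stack that is not listed is empty, so that states are compared through [nth]. *)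
Inductive exec : prog -> seq bitseq -> nat -> seq bitseq -> Prop :=
  | ExecSkip st : exec Skip st 0 st
  | ExecPush i x st : exec (Push i x) st 2 (set_nth [::] st i (x :: nth [::] st i))
  | ExecPop i st : exec (Pop i) st 1 (set_nth [::] st i (behead (nth [::] st i)))
  | ExecSeq p q st t st1 t' st2 :
      exec p st t st1 -> exec q st1 t' st2 -> exec (Seq p q) st (t + t').+1 st2
  | ExecIf i b p q st t st1 :
      exec (if b (top st i) then p else q) st t st1 -> exec (If i b p q) st t.+1 st1
  | ExecWhileEnd i b p st : ~~ b (top st i) -> exec (While i b p) st 0 st
  | ExecWhile i b p st t st1 t' st2 :
      b (top st i) -> exec p st t st1 -> exec (While i b p) st1 t' st2 ->
      exec (While i b p) st (t + t').+2 st2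
  | ExecConseq p st t st1 t' st2 :
      exec p st t st1 -> t <= t' -> nth [::] st1 =1 nth [::] st2 -> exec p st t' st2.

Lemma exec_le p st t st1 t' : exec p st t st1 -> t <= t' -> exec p st t' st1.
Proof. by move=> H le_t; apply: ExecConseq H le_t _. Qed.

(** A step adds at most one bit to a stack. This bounds the length of an output by the time spent
    producing it. *)
Lemma exec_size p st t st1 k :
  exec p st t st1 -> size (nth [::] st1 k) <= size (nth [::] st k) + t.
Proof.
move=> H; elim: H k => {p st t st1}.
- by move=> st k; rewrite addn0.
- by move=> i x st k; rewrite nth_set_nth /=; case: eqP => [->|_] /=; lia.
- by move=> i st k; rewrite nth_set_nth /=; case: eqP => [->|_] /=; rewrite ?size_behead; lia.
- by move=> p q st t st1 t' st2 _ IH1 _ IH2 k; move: (IH1 k) (IH2 k); lia.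
- by move=> i b p q st t st1 _ IH k; move: (IH k); lia.
- by move=> i b p st _ k; rewrite addn0.
- by move=> i b p st t st1 t' st2 _ _ IH1 _ IH2 k; move: (IH1 k) (IH2 k); lia.
- by move=> p st t st1 t' st2 _ IH le_t eq_st k; move: (IH k); rewrite -eq_st; lia.
Qed.

(** * Compilation of stack programs to Turing machines *)

Local Notation symbols := {ffun 'I_n.+1 -> cell void}.
Local Notation tapes := ('I_n.+1 -> tape void).

Record fragment := Fragment {
  fr_state : finType;
  fr_start : fr_state;
  fr_step : fr_state -> symbols -> option (fr_state * symbols * ('I_n.+1 -> move))
}.

Definition machine (F : fragment) : turing_machine :=
  @TuringMachine n void (fr_state F) (fr_start F) (@fr_step F).

Definition cell_bit (c : cell void) : option bool :=
  if c is Some (inl x) then Some x else None.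

Definition relabel (S S' : Type) (emb : S -> S')
    (o : option (S * symbols * ('I_n.+1 -> move))) :=
  if o is Some (q, x, m) then Some (emb q, x, m) else None.

Definition idle (S : Type) (q : S) (x : symbols) :
    option (S * symbols * ('I_n.+1 -> move)) :=
  Some (q, x, fun=> Stay).

Definition act_on (S : Type) (i : 'I_n.+1) (q : S) (x : symbols) (c : cell void) (m : move) :
    option (S * symbols * ('I_n.+1 -> move)) :=
  Some (q, [ffun k => if k == i then c else x k], fun k => if k == i then m else Stay).

Definition or_else (T : Type) (o o' : option T) := if o is Some _ then o else o'.

(** A fragment reports completion by halting. [Seq] and [While] turn the halting of a component into
    an idle transition to what follows; these transitions, and those that perform a successful test,
    account for the [.+1] and [.+2] in [exec]. *)
Fixpoint compile p : fragment :=
  match p with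
  | Skip => @Fragment unit tt (fun _ _ => None)
  (* A machine writes before it moves, so a push takes two steps. *)
  | Push i b => @Fragment (option bool) None (fun s x =>
      match s with
      | None => act_on i (Some false) x (x i) MoveLeft
      | Some false => act_on i (Some true) x (Some (inl b)) Stay
      | Some true => None
      end)
  | Pop i => @Fragment bool false (fun s x =>
      if s then None else act_on i true x (x i) MoveRight)
  | Seq p q =>
      let F := compile p in let G := compile q in
      @Fragment (fr_state F + fr_state G)%type (inl (fr_start F)) (fun s x =>
        match s with
        | inl s => or_else (relabel inl (fr_step s x)) (idle (inr (fr_start G)) x)
        | inr s => relabel inr (fr_step s x)
        end)
  | If i b p q =>
      let F := compile p in let G := compile q in
      @Fragment (option (fr_state F + fr_state G)) None (fun s x =>
        match s with
        | None => idle (Some (if b (cell_bit (x i)) then inl (fr_start F)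
                              else inr (fr_start G))) x
        | Some (inl s) => relabel (fun s => Some (inl s)) (fr_step s x)
        | Some (inr s) => relabel (fun s => Some (inr s)) (fr_step s x)
        end)
  | While i b p =>
      let F := compile p in
      @Fragment (option (fr_state F)) None (fun s x =>
        match s with
        | None => if b (cell_bit (x i)) then idle (Some (fr_start F)) x else None
        | Some s => or_else (relabel Some (fr_step s x)) (idle None x)
        end)
  end.

Definition heads (T : tapes) : symbols := [ffun i => tape_head (T i)].

Fixpoint reaches (F : fragment) (t : nat) (c c' : fr_state F * tapes) : Prop :=
  if t is t'.+1 then
    exists2 c1, @next_config (machine F) c = Some c1 & reaches t' c1 c'
  else c = c'.

Lemma reaches_trans F t t' (c c1 c2 : fr_state F * tapes) :
  reaches t c c1 -> reaches t' c1 c2 -> reaches (t + t') c c2.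
Proof.
elim: t c => [|t IH] c /=; first by move=> ->.
by case=> c0 step_c /IH H /H; exists c0.
Qed.

(** Only the non-halting steps of the component have to be matched, so the enclosing fragment is
    free to redirect its halting states. *)
Lemma reaches_relabel F G (emb : fr_state F -> fr_state G) :
  (forall s x r, fr_step s x = Some r -> fr_step (emb s) x = relabel emb (Some r)) ->
  forall t s T s' T', @reaches F t (s, T) (s', T') -> @reaches G t (emb s, T) (emb s', T').
Proof.
move=> emb_step; elim=> [|t IH] s T s' T' /=; first by case=> -> ->.
case=> -[s1 T1]; rewrite /next_config /=.
case step_s: fr_step => [[[s2 x] m]|] // [<- <-] /IH H.
by eexists; last exact: H; rewrite (emb_step _ _ _ step_s).
Qed.

(* The top of the stack is under the head; the cells to its left are arbitrary, so
   that popping need not erase. *)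
Definition stack_tape (s : bitseq) (tp : tape void) : Prop :=
  exists k, tape_head tp :: tape_right tp
            = [seq Some (inl x : bool + void) | x <- s] ++ nseq k None.

Definition holds_stacks (st : seq bitseq) (T : tapes) : Prop :=
  forall i : 'I_n.+1, stack_tape (nth [::] st i) (T i).

Lemma stack_tape_top s tp : stack_tape s tp -> cell_bit (tape_head tp) = ohead s.
Proof. by case=> k; case: s => [|x s] /=; [case: k => [|k] //= [->]|case=> ->]. Qed.

(** A push moves left onto an arbitrary cell and then overwrites it. The second conjunct serves the
    tapes that an instruction leaves alone. *)
Lemma stack_tape_push x c s tp : stack_tape s tp ->
  stack_tape (x :: s) (write_move (Some (inl x)) Stay
    (write_move (tape_head tp) MoveLeft tp)) /\
  stack_tape s (write_move (tape_head tp) Stay tp) /\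
  tape_head (write_move c Stay tp) = c.
Proof. by case: tp => l h r [k /= E]; do !split; exists k => //=; rewrite E. Qed.

Lemma stack_tape_pop s tp : stack_tape s tp ->
  stack_tape (behead s) (write_move (tape_head tp) MoveRight tp).
Proof.
case: tp => l h [|y r] [k] /=; case: s => [|x s] /=.
- by exists 1.
- by case=> _; case: s => [|//] _; exists 1.
- by case: k => [//|k] [_ E]; exists k.
- by case=> _ E; exists k.
Qed.

Definition idle_tapes (T : tapes) : tapes := fun i => write_move (heads T i) Stay (T i).

Lemma holds_idle st T : holds_stacks st T -> holds_stacks st (idle_tapes T).
Proof.
by move=> H i; have [_ [+ _]] := stack_tape_push true None (H i); rewrite /idle_tapes ffunE.
Qed.

Definition simulates p st t st1 := forall T, holds_stacks st T ->
  exists t0 s T1, [/\ t0 <= t, reaches t0 (fr_start (compile p), T) (s, T1),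
    @fr_step (compile p) s (heads T1) = None & holds_stacks st1 T1].

Lemma compile_correct p st t st1 : exec p st t st1 -> simulates p st t st1.
Proof.
elim=> {p st t st1}.
- by move=> st T H; exists 0, tt, T.
- move=> i x st T H.
  do 3 eexists; split; [exact: leqnn| | |].
  + by do 2 (eexists; first by rewrite /next_config /=; reflexivity).
  + by [].
  move=> k; rewrite nth_set_nth /= !ffunE.
  rewrite -(inj_eq val_inj) /=; case: eqP => [/val_inj ->|_].
    by case: (stack_tape_push x None (H i)).
  case: (stack_tape_push x None (H k)) => _ [].
  by case: (T k).
- move=> i st T H.
  do 3 eexists; split; [exact: leqnn| | |].
  + by eexists; first by rewrite /next_config /=; reflexivity.
  + by [].
  move=> k; rewrite nth_set_nth /= !ffunE.
  rewrite -(inj_eq val_inj) /=; case: eqP => [/val_inj ->|_].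
    exact: stack_tape_pop.
  by case: (stack_tape_push true None (H k)) => _ [].
- move=> p q st t st1 t' st2 _ IHp _ IHq T H.
  have [t1 [s1 [T1 [le_t1 R1 halt1 H1]]]] := IHp T H.
  have [t2 [s2 [T2 [le_t2 R2 halt2 H2]]]] := IHq _ (holds_idle H1).
  exists (t1 + t2.+1), (inr s2), T2; split=> //.
  + by rewrite addnS ltnS leq_add.
  + apply: (reaches_trans (F := compile (Seq p q)) (c1 := (inl s1, T1))).
      apply: (reaches_relabel (G := compile (Seq p q)) (emb := inl)) R1.
      by move=> s x [[s' x'] m] /= ->.
    exists (inr (fr_start (compile q)), idle_tapes T1).
      by rewrite /next_config /= halt1.
    apply: (reaches_relabel (G := compile (Seq p q)) (emb := inr)) R2.
    by move=> s x [[s' x'] m] /= ->.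
  + by rewrite /= halt2.
- move=> i b p q st t st1 _ IH T H.
  have top_i : b (cell_bit (heads T i)) = b (top st i).
    by rewrite ffunE (stack_tape_top (H i)).
  case b_i: (b (top st i)) IH => IH;
    have [t1 [s1 [T1 [le_t1 R1 halt1 H1]]]] := IH _ (holds_idle H).
  + exists t1.+1, (Some (inl s1)), T1; split=> //; last by rewrite /= halt1.
    exists (Some (inl (fr_start (compile p))), idle_tapes T).
      by rewrite /next_config /= top_i b_i.
    apply: (reaches_relabel (G := compile (If i b p q)) (emb := fun s => Some (inl s))) R1.
    by move=> s x [[s' x'] m] /= ->.
  + exists t1.+1, (Some (inr s1)), T1; split=> //; last by rewrite /= halt1.
    exists (Some (inr (fr_start (compile q))), idle_tapes T).
      by rewrite /next_config /= top_i b_i.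
    apply: (reaches_relabel (G := compile (If i b p q)) (emb := fun s => Some (inr s))) R1.
    by move=> s x [[s' x'] m] /= ->.
- move=> i b p st b_i T H; exists 0, None, T; split=> //=.
  by rewrite ffunE (stack_tape_top (H i)) (negbTE b_i).
- move=> i b p st t st1 t' st2 b_i _ IHp _ IHw T H.
  have [t1 [s1 [T1 [le_t1 R1 halt1 H1]]]] := IHp _ (holds_idle H).
  have [t2 [s2 [T2 [le_t2 R2 halt2 H2]]]] := IHw _ (holds_idle H1).
  exists (t1.+1 + t2.+1), s2, T2; split=> //.
  + by rewrite addSn addnS !ltnS leq_add.
  + apply: (reaches_trans (F := compile (While i b p)) (c1 := (Some s1, T1))).
      exists (Some (fr_start (compile p)), idle_tapes T).
        by rewrite /next_config /= ffunE (stack_tape_top (H i)) b_i.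
      apply: (reaches_relabel (G := compile (While i b p)) (emb := Some)) R1.
      by move=> s x [[s' x'] m] /= ->.
    by exists (None, idle_tapes T1); first by rewrite /next_config /= halt1.
- move=> p st t st1 t' st2 _ IH le_t eq_st T H.
  have [t1 [s1 [T1 [le_t1 R1 halt1 H1]]]] := IH _ H.
  exists t1, s1, T1; split=> //; first exact: leq_trans le_t.
  by move=> i; rewrite -eq_st.
Qed.

Lemma run_reaches F t t' (c : fr_state F * tapes) s T :
  reaches t c (s, T) -> fr_step s (heads T) = None -> t <= t' ->
  @run (machine F) t' c = Some (s, T).
Proof.
elim: t t' c => [|t IH] [|t'] c //=.
- by move=> -> halt _; rewrite /next_config /= halt.
- by move=> -> halt _; rewrite /next_config /= halt.
- by case=> c1 -> H halt le_t; rewrite (IH t').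
Qed.

Lemma exec_computes p t w st :
  exec p (w :: nseq n [::]) t st ->
  computes_within (machine (compile p)) t w (nth [::] st n).
Proof.
move=> /compile_correct H.
have [|t0 [s [T [le_t R halt HT]]]] := H (initial_config (machine (compile p)) w).2.
  move=> i /=; case: eqP => [->|/eqP i_neq0].
    (* An empty input still puts one explicit blank under the head. *)
    by case: w {H} => [|x w]; [exists 1|exists 0; rewrite /= cats0 -?map_comp].
  by case: i i_neq0 => -[|k] lt_k // _; exists 1; rewrite /= nth_nseq if_same.
exists (s, T); split; first exact: run_reaches R halt le_t.
have [k E] := HT ord_max.
change (leading_bits (M := machine (compile p)) (tape_head (T ord_max) :: tape_right (T ord_max))
  = nth [::] st n).
rewrite E /=; elim: (nth _ _ _) => [|x w' IH] /=; last by rewrite IH.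
by case: k {E}.
Qed.

End StackPrograms.

Lemma polynomial_time_exec n (p : prog n) (I J : Type) (P : I -> Prop)
    (codeI : I -> bitseq) (codeJ : J -> bitseq) (f : I -> J) (C e : nat) :
  (forall x, P x -> exists2 st,
     exec p (codeI x :: nseq n [::]) (C * size (codeI x) ^ e + C) st & nth [::] st n = codeJ (f x)) ->
  polynomial_time P codeI codeJ f.
Proof.
move=> H; exists (machine (compile p)), C, e => x /H[st /exec_computes + <-]; exact.
Qed.

(** * Arithmetic and elementary programs *)

Lemma leq_expn2r e a b : a <= b -> a ^ e <= b ^ e.
Proof. by move=> le_ab; case: e => // e; rewrite leq_exp2r. Qed.

(** Time bounds proportional to an [E]-th power of the length thus add up over consecutive pieces of
    the input without a growing constant. *)
Lemma leq_expnD E a b : 0 < E -> a ^ E + b ^ E <= (a + b) ^ E.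
Proof.
case: E => // E _; rewrite 3!expnSr mulnDr.
by apply: leq_add; apply: leq_mul => //; apply: leq_expn2r; rewrite ?leq_addl ?leq_addr.
Qed.

Definition emit_when (keep : bool) n (i : 'I_n.+1) (x : bool) : prog n :=
  if keep then Push i x else Skip n.

Definition bit_case n (i : 'I_n.+1) (p : bool -> prog n) : prog n :=
  If i (eq_op (Some true)) (p true) (p false).

Lemma exec_bit_case n (i : 'I_n.+1) p st x s t st1 :
  nth [::] st i = x :: s -> exec (p x) st t st1 -> exec (bit_case i p) st t.+1 st1.
Proof. by move=> st_i H; apply: ExecIf; rewrite /top st_i; case: x {st_i} H. Qed.

Definition move_top n (i j : 'I_n.+1) : prog n :=
  bit_case i (fun x => Seq (Pop i) (Push j x)).

Definition move_all n (i j : 'I_n.+1) : prog n := While i isSome (move_top i j).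

Definition clear n (i : 'I_n.+1) : prog n := While i isSome (Pop i).

Lemma exec_move_top n (i j : 'I_n.+1) st x s :
  nth [::] st i = x :: s ->
  exec (move_top i j) st 5
    (let st1 := set_nth [::] st i s in set_nth [::] st1 j (x :: nth [::] st1 j)).
Proof.
move=> st_i; apply: (exec_bit_case st_i); apply: (ExecSeq (ExecPop _ _)).
by rewrite st_i; apply: ExecPush.
Qed.

Lemma exec_move_all n (i j : 'I_n.+1) st :
  i != j ->
  exec (move_all i j) st (7 * size (nth [::] st i))
    (set_nth [::] (set_nth [::] st i [::]) j (rev (nth [::] st i) ++ nth [::] st j)).
Proof.
rewrite -(inj_eq val_inj) => /= i_neq_j; move: {2}(nth _ _ _) (erefl (nth [::] st i)) => s.
elim: s st => [|x s IH] st st_i; rewrite st_i.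
  apply: ExecConseq (leqnn _) _; first by apply: ExecWhileEnd; rewrite /top st_i.
  move=> k; rewrite nth_set_nth /= nth_set_nth /=.
  by case: (k =P nat_of_ord j) => [->|_] //; case: (k =P nat_of_ord i) => [->|_].
apply: ExecConseq (ExecWhile _ (exec_move_top _ st_i) (IH _ _)) _ _ => /=.
- by rewrite /top st_i.
- by rewrite !nth_set_nth /= (negbTE i_neq_j) !nth_set_nth /= eqxx.
- by rewrite !nth_set_nth /= (negbTE i_neq_j) !nth_set_nth /= eqxx; lia.
- move=> k; rewrite !nth_set_nth /= !nth_set_nth /= (negbTE i_neq_j) !nth_set_nth /=.
  have j_neq_i : (nat_of_ord j == i) = false by rewrite eq_sym (negbTE i_neq_j).
  rewrite (eqxx (nat_of_ord i)) (eqxx (nat_of_ord j)) j_neq_i rev_cons cat_rcons.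
  by case: (k == j) => //; case: eqP => // /eqP/negbTE k_neq_i; rewrite nth_set_nth /= k_neq_i.
Qed.

Lemma exec_clear n (i : 'I_n.+1) st :
  exec (clear i) st (3 * size (nth [::] st i)) (set_nth [::] st i [::]).
Proof.
move: {2}(nth _ _ _) (erefl (nth [::] st i)) => s.
elim: s st => [|x s IH] st st_i; rewrite st_i.
  apply: ExecConseq (leqnn _) _; first by apply: ExecWhileEnd; rewrite /top st_i.
  by move=> k; rewrite nth_set_nth /=; case: (k =P nat_of_ord i) => [->|_].
apply: ExecConseq (ExecWhile _ (ExecPop _ _) (IH _ _)) _ _ => /=.
- by rewrite /top st_i.
- by rewrite st_i !nth_set_nth /= eqxx.
- by rewrite st_i !nth_set_nth /= eqxx /=; lia.
- by move=> k; rewrite st_i !nth_set_nth /= !nth_set_nth /=; case: (k == i).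
Qed.

(** * Transducers *)

Notation stack k := (@Ordinal 8 k isT).
Notation inp := (stack 0).
Notation out := (stack 1).
Notation ctr := (stack 2).
Notation ctr' := (stack 3).
Notation scratch := (stack 4).
Notation tbl := (stack 5).
Notation tbl' := (stack 6).
Notation res := (stack 7).

(* The output is collected in reverse on [out]; [ctr] holds the arity of the
   current constraint in unary. *)
Definition io_state (w o k : bitseq) : seq bitseq :=
  [:: w; o; k; [::]; [::]; [::]; [::]; [::]].

Section Transducers.
Variable E : nat.
Hypothesis E_gt0 : 0 < E.

(** Quantifying over [rest] expresses that the program finds the end of [w] by itself. The exponent
    [E] is shared by all programs, so that bounds compose; [k] and [k'] are the contents of [ctr]
    before and after. *)
Definition transduces (p : prog 7) (w v k k' : bitseq) (C : nat) : Prop :=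
  forall rest o, exec p (io_state (w ++ rest) o k) (C * (size w).+1 ^ E)
    (io_state rest (rev v ++ o) k').

Lemma transduces_le p w v k k' t C :
  (forall rest o, exec p (io_state (w ++ rest) o k) t (io_state rest (rev v ++ o) k')) ->
  t <= C -> transduces p w v k k' C.
Proof.
move=> H le_t rest o; apply: exec_le (H rest o) _; apply: leq_trans le_t _.
by rewrite leq_pmulr ?expn_gt0.
Qed.

Lemma transduces_seq p q w1 w2 v1 v2 k k1 k2 C1 C2 :
  transduces p w1 v1 k k1 C1 -> transduces q w2 v2 k1 k2 C2 ->
  transduces (Seq p q) (w1 ++ w2) (v1 ++ v2) k k2 (C1 + C2).+1.
Proof.
move=> H1 H2 rest o; rewrite -catA rev_cat -catA.
apply: exec_le (ExecSeq (H1 _ _) (H2 _ _)) _.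
rewrite mulSn mulnDl addnC -addn1 addnC.
have pow_gt0 : 0 < (size (w1 ++ w2)).+1 ^ E by rewrite expn_gt0.
rewrite leq_add // addnC leq_add // leq_mul2l leq_exp2r // size_cat ltnS.
  by rewrite leq_addr orbT.
by rewrite leq_addl orbT.
Qed.

Definition copy_bit (keep : bool) : prog 7 :=
  bit_case inp (fun x => Seq (Pop inp) (emit_when keep out x)).

Lemma exec_copy_bit keep x rest o k :
  exec (copy_bit keep) (io_state (x :: rest) o k) 5
    (io_state rest (nseq keep x ++ o) k).
Proof.
apply: (@exec_bit_case _ inp _ _ x rest) => //; apply: (ExecSeq (ExecPop _ _)).
case: keep => /=; first exact: ExecPush.
by apply: exec_le; first exact: ExecSkip.
Qed.

Lemma transduces_copy_bit keep x k :
  transduces (copy_bit keep) [:: x] (nseq keep x) k k 5.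
Proof.
apply: transduces_le (leqnn _) => rest o.
by have := exec_copy_bit keep x rest o k; case: keep.
Qed.

Definition map_seq (keep : bool) (body : prog 7) : prog 7 :=
  Seq (While inp (eq_op (Some true)) (Seq (copy_bit keep) body)) (copy_bit keep).

(** By [leq_expnD], the constant does not depend on the number of items. The family [ctrs] lets the
    counter follow the number of items processed. *)
Lemma transduces_map_seq (T : Type) keep body (code v : T -> bitseq) (ctrs : nat -> bitseq) C xs :
  (forall x i, transduces body (code x) (v x) (ctrs i) (ctrs i.+1) C) ->
  transduces (map_seq keep body) (code_seq code xs)
    (flatten [seq nseq keep true ++ v x | x <- xs] ++ nseq keep false)
    (ctrs 0) (ctrs (size xs)) (C + 20).
Proof.
move=> H rest o.
(* The power has no [.+1] here: the separator bit in front of each item provides the [.+1] in the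
   bound of its body. *)
suff loop i : exec (While inp (eq_op (Some true)) (Seq (copy_bit keep) body))
    (io_state (code_seq code xs ++ rest) o (ctrs i))
    ((C + 10) * (size (code_seq code xs)) ^ E)
    (io_state (false :: rest) (rev (flatten [seq nseq keep true ++ v x | x <- xs]) ++ o)
       (ctrs (i + size xs))).
  have -> : rev (flatten [seq nseq keep true ++ v x | x <- xs] ++ nseq keep false) ++ o
      = nseq keep false ++ rev (flatten [seq nseq keep true ++ v x | x <- xs]) ++ o.
    by rewrite rev_cat -catA; case: (keep).
  apply: exec_le (ExecSeq (loop 0) (exec_copy_bit _ _ _ _ _)) _.
  have le_pow : size (code_seq code xs) ^ E <= (size (code_seq code xs)).+1 ^ E.
    by rewrite leq_exp2r.
  have pow_gt0 : 0 < (size (code_seq code xs)).+1 ^ E by rewrite expn_gt0.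
  by nia.
elim: xs i rest o => [|x xs IH] i rest o.
  by rewrite addn0; apply: exec_le; first exact: ExecWhileEnd.
have -> : code_seq code (x :: xs) = true :: code x ++ code_seq code xs.
  by rewrite /code_seq /= -catA.
rewrite cat_cons -catA; apply: exec_le; first apply: ExecWhile => //.
- apply: ExecSeq (exec_copy_bit _ _ _ _ _) _.
  exact: H.
- have -> : rev (flatten [seq nseq keep true ++ v x | x <- x :: xs]) ++ o
      = rev (flatten [seq nseq keep true ++ v x | x <- xs]) ++ rev (v x) ++ nseq keep true ++ o.
    by rewrite /= !rev_cat -!catA; case: (keep).
  by rewrite addnS -addSn; apply: IH.
have := leq_expnD (size (code x)).+1 (size (code_seq code xs)) E_gt0.
have pow_gt0 : 0 < (size (code x)).+1 ^ E by rewrite expn_gt0.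
rewrite /= size_cat addSn; nia.
Qed.

Definition emit_word (w : bitseq) : prog 7 := foldr (fun x p => Seq (Push out x) p) (Skip 7) w.

Lemma exec_emit_word v w o k :
  exec (emit_word v) (io_state w o k) (3 * size v) (io_state w (rev v ++ o) k).
Proof.
elim: v o => [|x v IH] o /=; first exact: ExecSkip.
apply: exec_le; first apply: (ExecSeq (ExecPush _ _ _)).
  by rewrite rev_cons cat_rcons; apply: IH.
by lia.
Qed.

(** The list is built into the program, so decoding a unary rank is a finite branching with one
    constant output word per branch. *)
Fixpoint unary_case (vs : seq bitseq) : prog 7 :=
  if vs is v :: vs' then
    bit_case inp (fun x => Seq (Pop inp) (if x then unary_case vs' else emit_word v))
  else Skip 7.

Definition unary (i : nat) : bitseq := rcons (nseq i true) false.

Lemma transduces_unary_case vs : exists C, forall i k, i < size vs ->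
  transduces (unary_case vs) (unary i) (nth [::] vs i) k k C.
Proof.
suff [C H] : exists C, forall i rest o k, i < size vs ->
    exec (unary_case vs) (io_state (unary i ++ rest) o k) C
      (io_state rest (rev (nth [::] vs i) ++ o) k).
  by exists C => i k lt_i; apply: transduces_le (leqnn _) => rest o; apply: H.
elim: vs => [|v vs [C IH]]; first by exists 0.
exists (C + 3 * size v + 3) => -[|i] rest o k lt_i.
  apply: exec_le; first apply: (@exec_bit_case _ inp _ _ false rest) => //.
    by apply: (ExecSeq (ExecPop _ _)); apply: exec_emit_word.
  by lia.
apply: exec_le; first apply: (@exec_bit_case _ inp _ _ true (unary i ++ rest)) => //.
  by apply: (ExecSeq (ExecPop _ _)); apply: (IH i).
by lia.
Qed.

End Transducers.

(** * Re-indexing truth tables *)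

Section Tables.
Variables (w o : bitseq).

Definition table_state (i o k k' s t u : bitseq) : seq bitseq :=
  [:: i; o; k; k'; s; t; u; [::]].

Definition copy_entry (keep : bool) : prog 7 :=
  bit_case tbl (fun x => Seq (Pop tbl) (Seq (Push scratch x) (emit_when keep tbl' x))).

(* Selects the entries of one group that [m] marks; [pad] adds the entry [false]. *)
Definition select_group (m : bitseq) (pad : bool) : prog 7 :=
  foldr (fun keep p => Seq (copy_entry keep) p) (emit_when pad tbl' false) m.

(** The entries read are restored from [scratch], because the table is scanned once for each
    mask. *)
Definition select_all (m : bitseq) (pad : bool) : prog 7 :=
  Seq (While tbl isSome (select_group m pad)) (move_all scratch tbl).

Definition selected (m : bitseq) (pad : bool) (g : bitseq) : bitseq :=
  mask m g ++ nseq pad false.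

Variables (k k' : bitseq).
Let state s t u := table_state w o k k' s t u.

Lemma exec_select_group m pad g s t u :
  size g = size m ->
  exec (select_group m pad) (state s (g ++ t) u) (9 * size m + 2)
    (state (rev g ++ s) t (rev (selected m pad g) ++ u)).
Proof.
elim: m g s u => [|keep m IH] [|x g] //= s u.
  by move=> _; case: pad => /=; [exact: ExecPush|apply: exec_le; first exact: ExecSkip].
case=> size_g; rewrite rev_cons cat_rcons.
have -> : rev (selected (keep :: m) pad (x :: g)) ++ u
    = rev (selected m pad g) ++ nseq keep x ++ u.
  by case: (keep); rewrite /selected /= ?rev_cons ?cat_rcons.
apply: exec_le; first apply: (ExecSeq _ (IH g (x :: s) _ size_g)).
  apply: (@exec_bit_case _ tbl _ _ x (g ++ t)) => //.
  apply: (ExecSeq (ExecPop _ _)); apply: (ExecSeq (ExecPush _ _ _)).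
  case: (keep) => /=; first exact: ExecPush.
  exact: exec_le (ExecSkip _ _) (leq0n 2).
by lia.
Qed.

Lemma exec_select_all m pad gs u :
  0 < size m -> all (fun g => size g == size m) gs ->
  exec (select_all m pad) (state [::] (flatten gs) u) (20 * size (flatten gs)).+1
    (state [::] (flatten gs) (rev (flatten (map (selected m pad) gs)) ++ u)).
Proof.
move=> m_gt0 gs_m.
have loop s : exec (While tbl isSome (select_group m pad)) (state s (flatten gs) u)
    (13 * size (flatten gs))
    (state (rev (flatten gs) ++ s) [::] (rev (flatten (map (selected m pad) gs)) ++ u)).
  elim: gs gs_m s u => [|g gs IH] /=.
    by move=> _ s u; apply: exec_le; first exact: ExecWhileEnd.
  case/andP=> /eqP size_g gs_m s u; rewrite 2!rev_cat -2!catA.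
  apply: exec_le; first apply: ExecWhile (exec_select_group _ _ _ _ size_g) (IH gs_m _ _).
    by case: (g) size_g m_gt0 => //= <-.
  by rewrite size_cat; lia.
have := loop [::]; rewrite cats0 => {}loop.
have back u' : exec (move_all scratch tbl) (state (rev (flatten gs)) [::] u')
    (7 * size (flatten gs)) (state [::] (flatten gs) u').
  have := @exec_move_all _ scratch tbl (state (rev (flatten gs)) [::] u') isT.
  by rewrite /= size_rev revK cats0.
by apply: exec_le (ExecSeq loop (back _)) _; lia.
Qed.

Definition reindex_table (L : seq (bitseq * bool)) : prog 7 :=
  Seq (foldr (fun l p => Seq (select_all l.1 l.2) p) (Skip 7) L)
      (Seq (clear tbl) (move_all tbl' tbl)).

(** The loop over the masks is the outer one, so their index becomes the first coordinate of the new
    table. *)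
Definition reindexed (L : seq (bitseq * bool)) (gs : seq bitseq) : bitseq :=
  flatten [seq flatten (map (selected l.1 l.2) gs) | l <- L].

Lemma exec_reindex_table L gs M :
  all (fun l => 0 < size l.1) L ->
  all (fun l => all (fun g => size g == size l.1) gs) L ->
  0 < M -> size (flatten gs) <= M -> size (reindexed L gs) <= M ->
  exec (reindex_table L) (state [::] (flatten gs) [::]) ((22 * size L + 12) * M)
    (state [::] (reindexed L gs) [::]).
Proof.
move=> L_gt0 gs_L M_gt0 le_gs le_L.
have select u : exec (foldr (fun l p => Seq (select_all l.1 l.2) p) (Skip 7) L)
    (state [::] (flatten gs) u) (22 * size L * M)
    (state [::] (flatten gs) (rev (reindexed L gs) ++ u)).
  elim: L L_gt0 gs_L u {le_L} => [|l L IH] /=.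
    by move=> _ _ u; rewrite muln0; apply: ExecSkip.
  case/andP=> l_gt0 L_gt0 /andP[gs_l gs_L] u.
  rewrite /reindexed /= rev_cat -catA.
  apply: exec_le; first exact: ExecSeq (exec_select_all _ _ l_gt0 gs_l) (IH L_gt0 gs_L _).
  by nia.
have := select [::]; rewrite cats0 => {}select.
have back : exec (move_all tbl' tbl) (state [::] [::] (rev (reindexed L gs)))
    (7 * size (reindexed L gs)) (state [::] (reindexed L gs) [::]).
  have := @exec_move_all _ tbl' tbl (state [::] [::] (rev (reindexed L gs))) isT.
  by rewrite /= size_rev revK cats0.
have erase u : exec (clear tbl) (state [::] (flatten gs) u) (3 * size (flatten gs))
    (state [::] [::] u) by exact: (@exec_clear _ tbl).
by apply: exec_le (ExecSeq select (ExecSeq (erase _) back)) _; nia.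
Qed.

End Tables.

(** A truth table has no end marker; [tbl] initially holds a template of the same length, which is
    consumed as a unary counter. *)
Definition read_table : prog 7 :=
  Seq (While tbl isSome (Seq (Pop tbl) (move_top inp tbl'))) (move_all tbl' tbl).

Lemma exec_read_table r rest o k' :
  exec read_table
    (table_state (r ++ rest) o [::] k' [::] (nseq (size r) true) [::])
    (17 * size r + 1) (table_state rest o [::] k' [::] r [::]).
Proof.
have loop t : exec (While tbl isSome (Seq (Pop tbl) (move_top inp tbl')))
    (table_state (r ++ rest) o [::] k' [::] (nseq (size r) true) t)
    (10 * size r) (table_state rest o [::] k' [::] [::] (rev r ++ t)).
  elim: r t => [|x r IH] t; first exact: ExecWhileEnd.
  rewrite rev_cons cat_rcons; apply: exec_le; first apply: ExecWhile (IH _) => //.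
    apply: (ExecSeq (ExecPop _ _)).
    exact: (@exec_move_top _ inp tbl' _ x (r ++ rest)).
  by rewrite /=; lia.
have back : exec (move_all tbl' tbl) (table_state rest o [::] k' [::] [::] (rev r))
    (7 * size r) (table_state rest o [::] k' [::] r [::]).
  have := @exec_move_all _ tbl' tbl (table_state rest o [::] k' [::] [::] (rev r)) isT.
  by rewrite /= size_rev revK cats0.
have := loop [::]; rewrite cats0 => {}loop.
by apply: exec_le (ExecSeq loop back) _; lia.
Qed.

Lemma flatten_map_flatten (S T : Type) (f : S -> seq T) (ss : seq (seq S)) :
  flatten (map f (flatten ss)) = flatten [seq flatten (map f s) | s <- ss].
Proof. by elim: ss => //= s ss <-; rewrite map_cat flatten_cat. Qed.

Fixpoint lists (T : Type) (l : seq T) (k : nat) : seq (seq T) :=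
  if k is k'.+1 then [seq x :: v | x <- l, v <- lists l k'] else [:: [::]].

(** In lexicographic order the last coordinate varies fastest, so tuples that differ only there are
    consecutive and form the groups of a round. *)
Lemma lists_rcons (T : Type) (l : seq T) k :
  lists l k.+1 = [seq rcons v x | v <- lists l k, x <- l].
Proof.
elim: k => [|k IH]; first by rewrite /= cats0; elim: l => //= x l ->.
rewrite [LHS]/= -/(lists l k.+1) {1}IH [lists l k.+1]/=.
rewrite flatten_map_flatten -map_comp; congr flatten; apply: eq_map => x /=.
by rewrite map_flatten -!map_comp; congr flatten; apply: eq_map => v /=; rewrite -map_comp.
Qed.

Lemma size_lists (T : Type) (l : seq T) k : size (lists l k) = size l ^ k.
Proof. by elim: k => //= k IH; rewrite size_allpairs IH expnS. Qed.

Lemma val_lex_tuples (D : finType) k : map val (lex_tuples D k) = lists (enum D) k.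
Proof.
elim: k => //= k IH; rewrite map_flatten -map_comp; congr flatten; apply: eq_map => x /=.
by rewrite -IH -!map_comp.
Qed.

Section Reindexing.
Variables (A B : finType) (p : A -> B) (P : pred A).
Hypothesis B_gt0 : 0 < #|B|.

Definition pull_rel (R : relation B) : relation A :=
  @Relation A (rel_arity R) [set t : _.-tuple A | all P t && (map_tuple p t \in rel_set R)].

(** Every group of [#|B|] entries yields exactly one: its entry at [p a], or the padding [false]
    outside [P]. *)
Definition pick_mask (a : A) : bitseq * bool :=
  if P a then ([seq b == p a | b <- enum B], false) else (nseq #|B| false, true).

Definition picks : seq (bitseq * bool) := map pick_mask (enum A).

Lemma selected_pick a (f : B -> bool) :
  selected (pick_mask a).1 (pick_mask a).2 (map f (enum B)) = [:: f (p a) && P a].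
Proof.
rewrite /selected /pick_mask; case: (P a) => /=; last by rewrite mask_false andbF.
rewrite cats0 andbT -map_mask -filter_mask.
by rewrite (@eq_filter _ _ (pred1 (p a))) // filter_pred1_uniq ?enum_uniq ?mem_enum.
Qed.

Section Mixed.
Variable F : seq B -> bool.

(** [F] takes its arguments in the original order: the coordinates already moved to the front of the
    table are its last arguments. *)
Definition mixed_entry (u : seq A) (v : seq B) : bool := F (v ++ map p u) && all P u.

(* The first [i] coordinates range over [A] and the last [j] over [B]; re-indexing
   turns the last coordinate into the first. *)
Definition mixed (i j : nat) : bitseq :=
  [seq mixed_entry u v | u <- lists (enum A) i, v <- lists (enum B) j].

Definition groups (i j : nat) : seq bitseq :=
  [seq [seq mixed_entry u (rcons v b) | b <- enum B] | u <- lists (enum A) i, v <- lists (enum B) j].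

Lemma size_mixed i j : size (mixed i j) = #|A| ^ i * #|B| ^ j.
Proof. by rewrite size_allpairs !size_lists -!cardE. Qed.

Lemma flatten_groups i j : flatten (groups i j) = mixed i j.+1.
Proof.
rewrite /groups /mixed lists_rcons; elim: (lists (enum A) i) => //= u us IH.
rewrite flatten_cat IH; congr cat; rewrite map_flatten -!map_comp; congr flatten.
by apply: eq_map => v /=; rewrite -map_comp.
Qed.

(** For [b = p a], the arguments [rcons v b ++ map p u] and [v ++ map p (a :: u)] coincide, so
    picking the entry at [p a] trades the last coordinate [b] for a first coordinate [a]. *)
Lemma reindexed_groups i j : reindexed picks (groups i j) = mixed i.+1 j.
Proof.
rewrite /reindexed /mixed [lists _ i.+1]/= flatten_map_flatten -!map_comp; congr flatten.
apply: eq_map => a /=; rewrite /groups flatten_map_flatten -!map_comp.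
congr flatten; apply: eq_map => u /=; rewrite -map_comp.
elim: (lists (enum B) j) => //= v vs ->; rewrite selected_pick -cat1s; congr (_ :: _).
by rewrite /mixed_entry /= cat_rcons -andbA [all P u && _]andbC.
Qed.

Lemma all_picks (q : nat -> bool) : q #|B| -> all (fun l => q (size l.1)) picks.
Proof.
move=> qB; rewrite all_map; apply/allP => a _ /=.
by rewrite /pick_mask; case: (P a); rewrite /= ?size_nseq // size_map -cardE.
Qed.

End Mixed.

(** Each mask copies the whole table in groups of one entry, so the length is multiplied by
    [#|B|]. *)
Definition replications : seq (bitseq * bool) := nseq #|B| ([:: true], false).

(** The first loop computes a template of length [#|B| ^ k] from the arity [k] on [ctr], and saves
    [k] on [ctr'] to count the rounds of the second loop. *)
Definition table_prog : prog 7 :=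
  Seq (Push tbl true)
  (Seq (While ctr isSome (Seq (Pop ctr) (Seq (Push ctr' true) (reindex_table replications))))
  (Seq read_table
  (Seq (While ctr' isSome (Seq (Pop ctr') (reindex_table picks)))
       (move_all tbl out)))).

Lemma exec_template w o i j M :
  #|B| ^ (j + i) <= M ->
  exec (While ctr isSome (Seq (Pop ctr) (Seq (Push ctr' true) (reindex_table replications))))
    (table_state w o (nseq j true) (nseq i true) [::] (nseq (#|B| ^ i) true) [::])
    (j * ((22 * #|B| + 12) * M + 10))
    (table_state w o [::] (nseq (j + i) true) [::] (nseq (#|B| ^ (j + i)) true) [::]).
Proof.
elim: j i => [|j IH] i le_M; first exact: ExecWhileEnd.
rewrite addSnnS in le_M *.
have M_gt0 : 0 < M by apply: leq_trans le_M; rewrite expn_gt0 B_gt0.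
have le_pow e : e <= j + i.+1 -> #|B| ^ e <= M.
  by move=> le_e; apply: leq_trans le_M; rewrite leq_pexp2l.
pose gs := nseq (#|B| ^ i) [:: true].
have gs_flat : flatten gs = nseq (#|B| ^ i) true.
  by rewrite /gs; elim: (_ ^ _) => //= e ->.
have gs_sel : reindexed replications gs = nseq (#|B| ^ i.+1) true.
  rewrite /reindexed /replications map_nseq /=.
  have -> : flatten (map (selected [:: true] false) gs) = nseq (#|B| ^ i) true.
    by rewrite /gs; elim: (_ ^ _) => //= e ->.
  by rewrite expnS; move: (#|B| ^ i) => e; elim: #|B| => //= b ->; rewrite mulSn nseqD.
apply: exec_le; first apply: ExecWhile (IH i.+1 le_M) => //.
  apply: (ExecSeq (ExecPop _ _)); apply: (ExecSeq (ExecPush _ _ _)).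
  rewrite -gs_flat -gs_sel.
  apply: (exec_reindex_table _ _ _ _ (M := M)) => //.
  + by rewrite all_nseq orbT.
  + by rewrite all_nseq /= all_nseq /= !orbT.
  + by rewrite gs_flat size_nseq le_pow // -addSnnS leq_addl.
  + by rewrite gs_sel size_nseq le_pow // leq_addl.
by rewrite size_nseq; nia.
Qed.

(** A round preserves the total number of coordinates, so [m ^ (i + j)] bounds every intermediate
    table. *)
Lemma exec_mixed F w o i j m :
  #|A| <= m -> #|B| <= m -> 0 < m ->
  exec (While ctr' isSome (Seq (Pop ctr') (reindex_table picks)))
    (table_state w o [::] (nseq j true) [::] (mixed F i j) [::])
    (j * ((22 * #|A| + 12) * m ^ (i + j) + 10))
    (table_state w o [::] [::] [::] (mixed F (i + j) 0) [::]).
Proof.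
move=> leA leB m_gt0; elim: j i => [|j IH] i; first by rewrite addn0; exact: ExecWhileEnd.
have le_mixed i' j' : size (mixed F i' j') <= m ^ (i' + j').
  by rewrite size_mixed expnD leq_mul //; apply: leq_expn2r.
rewrite -(addSnnS i j); apply: exec_le; first apply: ExecWhile (IH i.+1) => //.
  apply: (ExecSeq (ExecPop _ _)); rewrite -flatten_groups -reindexed_groups.
  apply: (exec_reindex_table _ _ _ _ (M := m ^ (i.+1 + j))).
  + exact: all_picks.
  + apply: (@all_picks (fun e => all (fun g => size g == e) _)).
    by apply/allP => g /allpairsP[uv [_ _ ->]]; rewrite size_map -cardE.
  + by rewrite expn_gt0 m_gt0.
  + by rewrite flatten_groups addSnnS.
  + by rewrite reindexed_groups.
rewrite /picks size_map -cardE mulSn; move: (_ * m ^ _) => c; lia.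
Qed.

Variable E : nat.
Hypotheses (B_gt1 : 1 < #|B|) (pow_E : (maxn #|A| #|B|) ^ 2 <= #|B| ^ E).

(** For [m] the larger cardinality, the loops make [k < m ^ k] rounds each, on tables of at most
    [m ^ k] entries. The time is thus a multiple of [(m ^ 2) ^ k], which [pow_E] bounds by the
    [E]-th power of the source length [#|B| ^ k]. *)
Lemma transduces_table : exists C, forall R : relation B,
  transduces E table_prog (code_rel R) (code_rel (pull_rel R))
    (nseq (rel_arity R) true) [::] C.
Proof.
pose c := 22 * #|A| + 22 * #|B| + 100.
exists (c * 2) => R rest o; set k := rel_arity R; set m := maxn #|A| #|B|.
(* Lists of a length other than [k] get a dummy value. *)
pose F (v : seq B) : bool :=
  if insub v : option (k.-tuple B) is Some t then t \in rel_set R else false.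
have F_tuple (t : k.-tuple B) : F t = (t \in rel_set R) by rewrite /F valK.
have source : code_rel R = mixed F 0 k.
  rewrite /mixed /= cats0 -val_lex_tuples -map_comp; apply: eq_map => t /=.
  by rewrite /mixed_entry cats0 andbT F_tuple.
have target : code_rel (pull_rel R) = mixed F k 0.
  rewrite /mixed /= -val_lex_tuples flatten_map1 -map_comp; apply: eq_map => t /=.
  by rewrite /mixed_entry inE andbC /= -(F_tuple (map_tuple p t)).
have size_source : size (mixed F 0 k) = #|B| ^ k by rewrite size_mixed mul1n.
have leA : #|A| <= m by exact: leq_maxl.
have leB : #|B| <= m by exact: leq_maxr.
have m_gt1 : 1 < m by exact: leq_trans leB.
have m_gt0 : 0 < m by exact: ltnW.
have table_gt0 : 0 < m ^ k by rewrite expn_gt0 m_gt0.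
have le_table : #|B| ^ k <= m ^ k by exact: leq_expn2r.
rewrite source target; set r := mixed F 0 k; set r' := mixed F k 0.
have init : exec (Push tbl true) (io_state (r ++ rest) o (nseq k true)) 2
    (table_state (r ++ rest) o (nseq k true) [::] [::] [:: true] [::]).
  exact: ExecPush.
have template := @exec_template (r ++ rest) o 0 k (m ^ k).
rewrite addn0 -{2}size_source in template.
have last : exec (move_all tbl out) (table_state rest o [::] [::] [::] r' [::])
    (7 * size r') (io_state rest (rev r' ++ o) [::]).
  exact: (@exec_move_all _ tbl out).
have read := exec_read_table r rest o (nseq k true).
have transform := exec_mixed F rest o 0 k leA leB m_gt0.
rewrite add0n in transform.
apply: exec_le (ExecSeq init (ExecSeq (template le_table)
  (ExecSeq read (ExecSeq transform last)))) _.
have le_r : size r <= m ^ k by rewrite size_source.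
have le_r' : size r' <= m ^ k by rewrite size_mixed muln1; apply: leq_expn2r.
have le_k : k.+1 <= m ^ k by exact: ltn_expl.
have le_pow : m ^ k * m ^ k <= (size r).+1 ^ E.
  apply: leq_trans (leq_expn2r E (leqnSn _)).
  rewrite size_source -expnMn -[m * m]/(m ^ 2) -[(_ ^ k) ^ E]expnM mulnC expnM.
  exact: leq_expn2r.
apply: leq_trans (leq_mul (leqnn _) le_pow).
set M := m ^ k in table_gt0 le_r le_r' le_k *; rewrite /c; clearbody M; nia.
Qed.
End Reindexing.

(** * The reduction *)

Definition nullary_rel (A B : finType) (R : relation B) : relation A :=
  @Relation A 0 [set t : 0.-tuple A | [exists u, u \in rel_set R]].

Section Translation.
Variables (A B : finType) (e : B -> A) (p : A -> B) (P : pred A).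

Definition translate_premises (ps : seq (var * B)) : seq (var * A) :=
  [seq (y.1, e y.2) | y <- ps].

(* When [#|B| = 1], the truth table of a [k]-ary relation over [A] is exponentially
   larger than the one over [B], but an invocation of a relation over [B] does not
   depend on its arguments. *)
Definition translate_constraint (c : ext_constraint B) : ext_constraint A :=
  if #|B| == 1 then
    @ExtConstraint A (translate_premises (premises c)) (nullary_rel A (constraint_rel c)) [tuple]
  else
    @ExtConstraint A (translate_premises (premises c)) (pull_rel p P (constraint_rel c)) (scope c).

Definition translate (phi : formula B) : formula A :=
  Formula (first_block phi) (later_blocks phi) (map translate_constraint (constraints phi)).

(** * The program for the translation and its running time *)

Section Computation.
Variable E : nat.
Hypothesis E_gt0 : 0 < E.

Definition read_var (keep : bool) : prog 7 := map_seq keep (copy_bit keep).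

Lemma transduces_read_var keep v k :
  transduces E (read_var keep) (code_var v) (if keep then code_var v else [::]) k k 25.
Proof.
have := @transduces_map_seq E E_gt0 _ keep (copy_bit keep) (fun x => [:: x]) (nseq keep)
  (fun=> k) 5 v (fun x _ => transduces_copy_bit E keep x k).
case: keep => //=; rewrite cats0.
by have -> : flatten [seq [::] | _ <- v] = [::] :> bitseq by elim: (v).
Qed.

Definition copy_block : prog 7 := map_seq true (read_var true).

Lemma transduces_copy_block X k :
  transduces E copy_block (code_seq code_var X) (code_seq code_var X) k k 45.
Proof.
apply: (transduces_map_seq E_gt0 true (ctrs := fun=> k) (v := code_var) (C := 25)) => x _.
exact: transduces_read_var.
Qed.

Definition premises_prog : prog 7 :=
  map_seq true (Seq (read_var true) (unary_case [seq code_elt (e b) | b <- enum B])).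

Lemma transduces_premises : exists C, forall ps k,
  transduces E premises_prog (code_seq (fun y => code_var y.1 ++ code_elt y.2) ps)
    (code_seq (fun y => code_var y.1 ++ code_elt y.2) (translate_premises ps)) k k C.
Proof.
have [C H] := transduces_unary_case E_gt0 [seq code_elt (e b) | b <- enum B].
eexists => ps k; rewrite /code_seq -map_comp.
apply: (transduces_map_seq E_gt0 true (ctrs := fun=> k)
  (v := fun y => code_var y.1 ++ code_elt (e y.2))) => -[y b] _ /=.
refine (transduces_seq E_gt0 (transduces_read_var true _ _) _).
have := H (enum_rank b) k; rewrite size_map -cardE (nth_map b) -?cardE // nth_enum_rank.
by apply.
Qed.

(** The arity is counted on [ctr] along the way, for [table_prog]. *)
Definition scope_prog : prog 7 := map_seq true (Seq (read_var true) (Push ctr true)).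

Lemma transduces_scope X :
  transduces E scope_prog (code_seq code_var X) (code_seq code_var X) [::]
    (nseq (size X) true) 48.
Proof.
apply: (transduces_map_seq E_gt0 true (ctrs := fun i => nseq i true) (v := code_var) (C := 28)).
move=> x i; rewrite -[code_var x]cats0.
refine (transduces_seq E_gt0 (transduces_read_var true _ _) _).
by apply: transduces_le (leqnn 2) => rest o; apply: ExecPush.
Qed.

Definition drop_scope_prog : prog 7 := Seq (map_seq false (read_var false)) (Push out false).

Lemma transduces_drop_scope X k :
  transduces E drop_scope_prog (code_seq code_var X) [:: false] k k 48.
Proof.
have H : transduces E (map_seq false (read_var false)) (code_seq code_var X) [::] k k 45.
  have := @transduces_map_seq E E_gt0 _ false (read_var false) code_var (fun=> [::])
    (fun=> k) 25 X (fun x _ => transduces_read_var false x k).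
  rewrite /= cats0.
  by have -> : flatten [seq [::] | _ <- X] = [::] :> bitseq by elim: (X).
rewrite -[code_seq _ _]cats0 -[[:: false]]cat0s.
refine (transduces_seq E_gt0 H _).
by apply: transduces_le (leqnn 2) => rest o; apply: ExecPush.
Qed.

Definition constraint_prog : prog 7 :=
  Seq premises_prog (if #|B| == 1 then Seq drop_scope_prog (copy_bit true)
                     else Seq scope_prog (table_prog p P)).

Definition formula_prog : prog 7 :=
  Seq copy_block (Seq (map_seq true (Seq copy_block copy_block))
                      (map_seq true constraint_prog)).

Hypothesis B_gt0 : 0 < #|B|.
Hypothesis pow_E : 1 < #|B| -> (maxn #|A| #|B|) ^ 2 <= #|B| ^ E.

(** Over a singleton there is one tuple of each length, so both tables are a single bit, which the
    program just copies. *)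
Lemma code_rel_singleton (R : relation B) :
  #|B| = 1 -> code_rel R = code_rel (nullary_rel A R).
Proof.
move=> B1; rewrite /code_rel /= inE.
have size_lex : size (lex_tuples B (rel_arity R)) = 1.
  by rewrite -(size_map val) val_lex_tuples size_lists -cardE B1 exp1n.
case: lex_tuples size_lex => [|t [|]] //= _; congr [:: _].
apply/idP/existsP => [Rt|[u Ru]]; first by exists t.
have/card_le1P : #|{: (rel_arity R).-tuple B}| <= 1 by rewrite card_tuple B1 exp1n.
by move=> /(_ t isT u); rewrite !inE => /esym/eqP <-.
Qed.

Lemma transduces_constraint : exists C, forall c,
  transduces E constraint_prog (code_constraint c)
    (code_constraint (translate_constraint c)) [::] [::] C.
Proof.
have [C1 H1] := transduces_premises.
rewrite /constraint_prog /translate_constraint; case: eqP => [B1|/eqP B_neq1].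
  eexists => c; refine (transduces_seq E_gt0 (H1 _ _) _).
  refine (transduces_seq E_gt0 (transduces_drop_scope _ _) _).
  rewrite -code_rel_singleton //=.
  have : size (code_rel (constraint_rel c)) = 1.
    by rewrite (code_rel_singleton _ B1) size_map.
  case: code_rel => [|x []] // _; exact: transduces_copy_bit.
have B_gt1 : 1 < #|B| by rewrite ltn_neqAle eq_sym B_neq1.
have [C2 H2] := transduces_table p P B_gt0 B_gt1 (pow_E B_gt1).
eexists => c; refine (transduces_seq E_gt0 (H1 _ _) _).
refine (transduces_seq E_gt0 (transduces_scope _) _).
by rewrite size_tuple; apply: H2.
Qed.

Lemma transduces_formula : exists C, forall phi,
  transduces E formula_prog (code_formula phi) (code_formula (translate phi)) [::] [::] C.
Proof.
have [C H] := transduces_constraint.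
eexists => phi; refine (transduces_seq E_gt0 (transduces_copy_block _ _) _).
refine (transduces_seq E_gt0 _ _).
  apply: (transduces_map_seq E_gt0 true (ctrs := fun=> [::])
    (v := fun q => code_seq code_var q.1 ++ code_seq code_var q.2)) => q _.
  exact (transduces_seq E_gt0 (transduces_copy_block _ _) (transduces_copy_block _ _)).
rewrite [code_seq _ (constraints (translate phi))]/code_seq -map_comp.
apply: (transduces_map_seq E_gt0 true (ctrs := fun=> [::])
  (v := fun c => code_constraint (translate_constraint c))) => c _.
exact: H.
Qed.

End Computation.

Lemma polynomial_time_translate (I : formula B -> Prop) :
  0 < #|B| -> polynomial_time I (@code_formula B) (@code_formula A) translate.
Proof.
move=> B_gt0; set m := maxn #|A| #|B|.
have E_gt0 : 0 < m ^ 2 by rewrite expn_gt0 leq_max B_gt0 orbT.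
have [|C H] := transduces_formula E_gt0 B_gt0.
  (* For [E = m ^ 2] the condition is an instance of [n < b ^ n] with [b > 1]. *)
  by move=> B_gt1; apply: ltnW; apply: ltn_expl.
(* Moving the output to [res] costs 7 per bit, and the output is no longer than the time spent on
   it, whence [8 * C]. The factor [2 ^ E] pays for passing from the length plus one to the
   length. *)
set E := m ^ 2 in E_gt0 H; pose D := 8 * C * 2 ^ E + 1.
apply: (@polynomial_time_exec 7 (Seq formula_prog (move_all out res)) _ _ _ _ _ _ D E).
move=> phi _; have := H phi [::] [::]; rewrite !cats0 => exec_phi.
have := exec_size 1 exec_phi; rewrite /= size_rev => size_out.
exists (set_nth [::] (set_nth [::] (io_state [::] (rev (code_formula (translate phi))) [::]) 1 [::])
  7 (code_formula (translate phi))) => //.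
have move_out := @exec_move_all _ out res
  (io_state [::] (rev (code_formula (translate phi))) [::]) isT.
rewrite /= revK cats0 size_rev in move_out.
apply: exec_le (ExecSeq exec_phi move_out) _.
have : (size (code_formula phi)).+1 ^ E <= 2 ^ E * (size (code_formula phi) ^ E + 1).
  case: (size _) => [|N]; first by rewrite exp1n muln_gt0 expn_gt0 addn1.
  apply: leq_trans (_ : 2 ^ E * N.+1 ^ E <= _); last by rewrite leq_mul2l leq_addr orbT.
  by rewrite -expnMn; apply: leq_expn2r; lia.
rewrite /D; move: (_ ^ E) (_.+1 ^ E) (2 ^ E) size_out => X Y Z; nia.
Qed.

End Translation.

(** * Preservation of truth *)

Section TranslationTruth.
Variables (A B : finType) (e : B -> A) (p : A -> B) (P : pred A).
Hypotheses (eK : cancel e p) (P_e : forall b, P (e b)).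

Local Notation translate := (translate e p P).
Local Notation translate_constraint := (translate_constraint e p P).

Lemma premises_translate c : premises (translate_constraint c) = translate_premises e (premises c).
Proof. by rewrite /translate_constraint; case: ifP. Qed.

(** A premise [a' y = e d] forces [a y = p (e d) = d], so the translated constraint is active only
    if the original one is. *)
Lemma satisfies_translate c (a : var -> B) (a' : var -> A) :
  (forall v, p (a' v) = a v) -> all (fun x => P (a' x)) (scope c) ->
  satisfies a c -> satisfies a' (translate_constraint c).
Proof.
move=> pa' Pa' /implyP sat_c; apply/implyP; rewrite premises_translate all_map => prem.
have {}sat_c : map_tuple a (scope c) \in rel_set (constraint_rel c).
  by apply: sat_c; apply: sub_all prem => y /= /eqP a'y; rewrite -pa' a'y eK.
rewrite /translate_constraint; case: ifP => _ /=; rewrite inE.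
  by apply/existsP; eexists; exact: sat_c.
rewrite all_map Pa' /=; suff -> : map_tuple p (map_tuple a' (scope c)) = map_tuple a (scope c) by [].
by apply: val_inj; rewrite /= -map_comp; apply: eq_map => v /=.
Qed.

(** Here premises pass from [a] to [a'], which requires [a'] to agree with [e \o a] on their
    variables. *)
Lemma translate_satisfies c (a : var -> B) (a' : var -> A) :
  (forall v, p (a' v) = a v) -> all (fun y => a' y.1 == e (a y.1)) (premises c) ->
  satisfies a' (translate_constraint c) -> satisfies a c.
Proof.
move=> pa' a'e /implyP sat_c; apply/implyP => prem; move: sat_c.
rewrite premises_translate all_map => sat_c.
have {sat_c} : map_tuple a' (scope (translate_constraint c)) \in
    rel_set (constraint_rel (translate_constraint c)).
  apply: sat_c; have := conj a'e prem => /andP; rewrite -all_predI.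
  by apply: sub_all => y /= /andP[/eqP -> /eqP ->].
rewrite /translate_constraint; case: ifP => [/eqP B1|_] /=; rewrite inE.
  (* Over a singleton, the witness [u] is the only tuple of its length. *)
  case/existsP=> u Ru; suff -> : map_tuple a (scope c) = u by [].
  have/card_le1P : #|{: (rel_arity (constraint_rel c)).-tuple B}| <= 1.
    by rewrite card_tuple B1 exp1n.
  by move=> /(_ u isT (map_tuple a (scope c))); rewrite !inE => /esym/eqP.
case/andP=> _; suff -> : map_tuple p (map_tuple a' (scope c)) = map_tuple a (scope c) by [].
by apply: val_inj; rewrite /= -map_comp; apply: eq_map => v /=.
Qed.

(** Universal values are projected by [p] and the answers lifted by [e]. Membership in [P] is
    maintained only on [X], since universal values over [A] are arbitrary. *)
Lemma eval_translate (X : pred var) qs cs (a : var -> B) (a' : var -> A) :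
  all (fun q => all (predC X) q.1) qs -> all (fun c => all X (scope c)) cs ->
  (forall v, p (a' v) = a v) -> (forall v, X v -> P (a' v)) ->
  eval qs cs a -> eval qs (map translate_constraint cs) a'.
Proof.
move=> + X_cs; elim: qs a a' => [|[Ys Xs] qs IH] a a' /=.
  move=> _ pa' Pa'; elim: cs X_cs => //= c cs IH /andP[X_c /IH{}IH] /andP[sat_c /IH ->].
  by rewrite andbT; apply: satisfies_translate sat_c => //; apply: sub_all X_c.
case/andP=> /allP Ys_X qs_X pa' Pa' win b'.
have [b win_b] := win (p \o b'); exists (e \o b).
apply: IH win_b => // v; rewrite /override.
  by case: ifP => _ /=; [rewrite eK|case: ifP].
by case: ifP => //= _ Xv; case: ifP => [/Ys_X /negP|_ //]; last exact: Pa'.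
Qed.

(** Universal values are lifted by [e] and the answers projected by [p]. Agreement with [e \o a] is
    not yet demanded of variables whose universal block is still ahead; once established it
    persists, as existential blocks avoid [Y]. *)
Lemma translate_eval (Y : pred var) qs cs (a : var -> B) (a' : var -> A) :
  all (fun q => all (predC Y) q.2) qs ->
  all (fun c => all (fun y => Y y.1) (premises c)) cs ->
  (forall v, p (a' v) = a v) ->
  (forall v, Y v -> (v \in flatten (unzip1 qs)) || (a' v == e (a v))) ->
  eval qs (map translate_constraint cs) a' -> eval qs cs a.
Proof.
move=> + Y_cs; elim: qs a a' => [|[Ys Xs] qs IH] a a' /=.
  move=> _ pa' a'e; elim: cs Y_cs => //= c cs IH /andP[Y_c /IH{}IH] /andP[sat_c /IH ->].
  by rewrite andbT; apply: translate_satisfies sat_c => //; apply: sub_all Y_c => y /a'e.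
case/andP=> /allP Xs_Y qs_Y pa' a'e win b.
have [b' win_b] := win (e \o b); exists (p \o b').
apply: IH win_b => // v; rewrite /override.
  by case: ifP => _ //=; case: ifP => _ //=; rewrite eK.
move=> Yv; have := a'e v Yv; rewrite mem_cat.
case: ifP => [/Xs_Y /negP //|_]; case: ifP => //= _ _.
by rewrite eqxx orbT.
Qed.

Lemma flatten_blocks_perm (phi : formula B) :
  perm_eq (flatten (blocks phi)) (existential_vars phi ++ universal_vars phi).
Proof.
rewrite /blocks /existential_vars /universal_vars /= -catA perm_cat2l.
elim: later_blocks => //= -[Y X] qs IH /=.
by apply/permP => q; move/permP/(_ q): IH; rewrite !count_cat; lia.
Qed.

Lemma truth_translate phi : well_formed phi -> truth phi <-> truth (translate phi).
Proof.
case/and3P=> uniq_vars _ cs_vars.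
have disj v : v \in existential_vars phi -> v \notin universal_vars phi.
  move: uniq_vars; rewrite (perm_uniq (flatten_blocks_perm phi)) cat_uniq.
  case/and3P=> _ /hasPn disj _ v_ex; apply/negP => /disj; by rewrite v_ex.
have blocks_sub q : List.In q (later_blocks phi) ->
    {subset q.1 <= universal_vars phi} /\ {subset q.2 <= existential_vars phi}.
  rewrite /universal_vars /existential_vars; move: (first_block phi) => X1.
  elim: later_blocks => //= q' qs IH [->|/IH[IH1 IH2]]; split=> v v_q.
  - by rewrite mem_cat v_q.
  - by rewrite !mem_cat v_q orbT.
  - by rewrite mem_cat IH1 ?orbT.
  - by have := IH2 v v_q; rewrite !mem_cat => /orP[->|->]; rewrite ?orbT.
have all_In (T : Type) (q : pred T) s : (forall x, List.In x s -> q x) -> all q s.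
  by elim: s => //= x s IH H; rewrite H ?IH //; [move=> y ?; apply: H; right|left].
split=> -[].
- move=> a win; exists (e \o a).
  apply: (@eval_translate (mem (existential_vars phi))) win => //=.
  + apply: all_In => q /blocks_sub[sub1 _]; apply/allP => v /sub1.
    by apply: contraL => /disj.
  + by apply: sub_all cs_vars => c /andP[].
- move=> a' win; exists (p \o a').
  apply: (@translate_eval (mem (universal_vars phi))) win => //=.
  + by apply: all_In => q /blocks_sub[_ sub2]; apply/allP => v /sub2/disj.
  + by apply: sub_all cs_vars => c /andP[].
  (* At the start every universal variable is still to be quantified. *)
  + by move=> v; rewrite /universal_vars => ->.
Qed.

Lemma well_formed_translate phi : well_formed phi -> well_formed (translate phi).
Proof.
case/and3P=> ? ? cs_vars; apply/and3P; split=> //.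
rewrite all_map; apply: sub_all cs_vars => c /= /andP[ps_vars xs_vars].
rewrite premises_translate all_map ps_vars /=.
by rewrite /translate_constraint; case: ifP.
Qed.

End TranslationTruth.

(** * Preservation of invariance, and the two reductions *)

Section AlgebraReduction.
Variables (s : signature) (A B : algebra s) (e : B -> A) (p : A -> B) (P : pred A).
Hypotheses (eK : cancel e p) (P_e : forall b, P (e b)).
Hypothesis p_op : forall (f : symbol s) (t : (arity f).-tuple A),
  all P t -> P (op t) /\ p (op t) = op (map_tuple p t).

(** [p_op] is applied at each coordinate [i] to [args i]: its first half keeps the result in [P],
    its second half lets [p] commute with the operation. *)
Lemma Inv_pull_rel (R : relation B) :
  Inv (@basic_op s B) R -> Inv (@basic_op s A) (pull_rel p P R).
Proof.
move=> inv_R k mu [f] ts ts_R.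
pose args i := [tuple tnth (tnth ts j) i | j < arity f].
have args_P i : all P (args i).
  apply/allP => _ /mapP[j _ ->].
  by have := ts_R j; rewrite inE => /andP[/allP + _]; apply; apply: mem_tnth.
rewrite inE; apply/andP; split.
  by apply/allP => _ /mapP[i _ ->]; case: (p_op (args_P i)).
have := inv_R _ _ (BasicOp B f) (map_tuple (map_tuple p) ts).
have -> : coordinatewise (op (f := f)) (map_tuple (map_tuple p) ts)
    = map_tuple p (coordinatewise (op (f := f)) ts).
  apply: eq_from_tnth => i; rewrite [RHS]tnth_map !tnth_mktuple.
  rewrite (p_op (args_P i)).2; congr op; apply: eq_from_tnth => j.
  by rewrite [RHS]tnth_map !tnth_mktuple !tnth_map.
by apply=> j; rewrite tnth_map; have := ts_R j; rewrite inE => /andP[].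
Qed.

(** If [R] were empty, [ts_R] would be contradictory for each argument [j], so [inv_R] would apply
    to arbitrary tuples and put one into [R]. This covers symbols of arity zero as well. *)
Lemma Inv_nullary_rel (R : relation B) :
  Inv (@basic_op s B) R -> Inv (@basic_op s A) (nullary_rel A R).
Proof.
move=> inv_R k mu [f] ts ts_R; rewrite inE; apply: contraT => R0.
have b : B by have/card_gt0P/sigW[b _] := universe_nonempty B.
move/existsPn: (R0) => /(_ (coordinatewise (op (f := f))
  [tuple nseq_tuple (rel_arity R) b | j < arity f]))/negP[].
apply: (inv_R _ _ (BasicOp B f)) => j.
by have := ts_R j; rewrite inE (negbTE R0).
Qed.

Lemma uniformly_reduces_translate : uniformly_reduces (QCSPE B) (QCSPE A).
Proof.
exists (translate e p P); split.
  exact: polynomial_time_translate (universe_nonempty B).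
move=> phi [wf_phi inv_phi]; split=> //; last exact: truth_translate.
split=> /=; first exact: well_formed_translate.
move=> c'; elim: (constraints phi) inv_phi => //= c cs IH inv_cs [<-|].
  have inv_c := inv_cs c (or_introl erefl); rewrite /translate_constraint.
  by case: ifP => _ /=; [apply: Inv_nullary_rel|apply: Inv_pull_rel].
by apply: IH => c1 c1_cs; apply: inv_cs; right.
Qed.

End AlgebraReduction.

Theorem mainTheorem15 (s : signature) (A : algebra s) :
  (forall S : subuniverse A, uniformly_reduces (QCSPE (subalgebra S)) (QCSPE A)) /\
  (forall B : algebra s, homomorphic_image A B ->
     uniformly_reduces (QCSPE B) (QCSPE A)).
Proof.
split=> [S|B [h [h_hom h_surj]]].
  have/card_gt0P/sigW[b0 _] := universe_nonempty (subalgebra S).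
  pose e (b : subalgebra S) : A := val b.
  (* The retraction sends everything outside the carrier to the arbitrary element [b0]. *)
  have eK : cancel e (insubd b0) by exact: valKd.
  apply: (uniformly_reduces_translate (P := mem (carrier S)) eK).
    by move=> b; exact: valP.
  move=> f t /allP t_S; have op_S := carrier_closed t_S; split=> //.
  apply: val_inj; rewrite /= insubdK //; congr op; apply: val_inj => /=.
  by rewrite -map_comp map_id_in // => x /t_S x_S /=; rewrite insubdK.
(* Surjectivity in boolean form, so that [xchoose] yields a section of [h]. *)
have h_surj' b : exists a, h a == b by have [a <-] := h_surj b; exists a.
apply: (uniformly_reduces_translate (P := xpredT) (p := h) (e := fun b => xchoose (h_surj' b))) => //.
by move=> b; apply/eqP; exact: (xchooseP (h_surj' b)).
Qed.
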